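(* Let $z_1=(x_1,y_1)$, $z_2=(x_2,y_2)$, $z_3=(x_3,y_3)$ be distinct points of $\mathbb{Z}^2$, let $d\ge d_3(z_1,z_2,z_3)$ be an integer and $c=d-d_3(z_1,z_2,z_3)$. Define $\alpha_1=\max\{\min\{x_1,x_2\},\min\{x_1,x_3\}\}$, $\beta_1=\min\{\max\{x_1,x_2\},\max\{x_1,x_3\}\}$, $\gamma_1=\max\{\min\{y_1,y_2\},\min\{y_1,y_3\}\}$, $\delta_1=\min\{\max\{y_1,y_2\},\max\{y_1,y_3\}\}$; $\alpha_2=\max\{\min\{x_1,x_2\},\min\{x_2,x_3\}\}$, $\beta_2=\min\{\max\{x_1,x_2\},\max\{x_2,x_3\}\}$, $\gamma_2=\max\{\min\{y_1,y_2\},\min\{y_2,y_3\}\}$, $\delta_2=\min\{\max\{y_1,y_2\},\max\{y_2,y_3\}\}$; $\alpha_3=\max\{\min\{x_1,x_3\},\min\{x_2,x_3\}\}$, $\beta_3=\min\{\max\{x_1,x_3\},\max\{x_2,x_3\}\}$, $\gamma_3=\max\{\min\{y_1,y_3\},\min\{y_2,y_3\}\}$, $\delta_3=\min\{\max\{y_1,y_3\},\max\{y_2,y_3\}\}$. Then the set ${\cal A}_d(z_1,z_2,z_3)=\{z\in\mathbb{Z}^2: d_4(z_1,z_2,z_3,z)\le d\}$ equals ${\mathscr O}_1\cup{\mathscr O}_2\cup{\mathscr O}_3$, where for $i=1,2,3$, ${\mathscr O}_i$ is the set of $(x,y)\in\mathbb{Z}^2$ with $\alpha_i-c\le x\le\beta_i+c$,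 $\gamma_i-c\le y\le\delta_i+c$, $\alpha_i+\gamma_i-c\le x+y\le\beta_i+\delta_i+c$, $\alpha_i-\delta_i-c\le x-y\le\beta_i-\gamma_i+c$.
   Context: The grid graph ${\cal G}_2$ has vertex set $\mathbb{Z}^2$, with $z,z'$ adjacent iff their $L_1$-distance is $1$. The tristance $d_3(z_1,z_2,z_3)$ (resp. quadristance $d_4(z_1,z_2,z_3,z_4)$) of points of $\mathbb{Z}^2$ is the minimum number of edges of a tree in ${\cal G}_2$ (possibly using additional vertices) containing the three (resp. four) given points. *)

(* Defs.v *)
From mathcomp Require Import all_boot all_order all_algebra.
From mathcomp Require Import finmap.
From mathcomp Require Import boolp classical_sets.

Set Implicit Arguments.
Unset Strict Implicit.
Unset Printing Implicit Defensive.

Import Order.TTheory GRing.Theory Num.Theory.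

Local Open Scope ring_scope.

Definition gpoint : Type := (int * int)%type.

Definition grid_adj (z z' : gpoint) : bool :=
  `|z.1 - z'.1| + `|z.2 - z'.2| == 1.

Record fgraph := FGraph {
  vertices : {fset gpoint};
  edges : {fset {fset gpoint}}
}.

Definition grid_subgraph (G : fgraph) : Prop :=
  forall e : {fset gpoint}, e \in edges G ->
    exists u v : gpoint,
      [/\ u \in vertices G, v \in vertices G, grid_adj u v & e = [fset u; v]%fset].

(* In a subgraph of the grid every edge has two distinct endpoints, so this
   relation is irreflexive there: [fset u; u] is never an edge. *)
Definition adj (G : fgraph) : rel gpoint :=
  fun u v => [fset u; v]%fset \in edges G.

Definition connected_graph (G : fgraph) : Prop :=
  (exists u : gpoint, u \in vertices G) /\
  (forall u v : gpoint, u \in vertices G -> v \in vertices G ->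
    exists p : seq gpoint, path (adj G) u p /\ last u p = v).

(* ucycle allows the degenerate cycles of length at most 2 (in particular an
   edge traversed back and forth), which are not cycles of a simple graph. *)
Definition acyclic_graph (G : fgraph) : Prop :=
  forall s : seq gpoint, (2 < size s)%N -> ~ ucycle (adj G) s.

Definition grid_tree (G : fgraph) : Prop :=
  [/\ grid_subgraph G, connected_graph G & acyclic_graph G].

Definition spanned_by (s : seq gpoint) (n : nat) : Prop :=
  exists G : fgraph,
    [/\ grid_tree G, {subset s <= vertices G} & #|` edges G|%fset = n].

(* The default value 0 is never used for the sets considered below: the grid is
   connected, so any finite set of points lies in some tree. *)
Definition min_nat (P : nat -> Prop) : nat :=
  xget 0%N [set n : nat | P n /\ forall m : nat, P m -> (n <= m)%N]%classic.

Definition tristance (z1 z2 z3 : gpoint) : nat :=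
  min_nat (spanned_by [:: z1; z2; z3]).

Definition quadristance (z1 z2 z3 z4 : gpoint) : nat :=
  min_nat (spanned_by [:: z1; z2; z3; z4]).

Definition anticode (d : int) (z1 z2 z3 : gpoint) : set gpoint :=
  [set z : gpoint | (quadristance z1 z2 z3 z)%:Z <= d]%classic.

Definition octagon (c alpha beta gamma delta : int) : set gpoint :=
  [set z : gpoint |
    [/\ alpha - c <= z.1 <= beta + c,
        gamma - c <= z.2 <= delta + c,
        alpha + gamma - c <= z.1 + z.2 <= beta + delta + c &
        alpha - delta - c <= z.1 - z.2 <= beta - gamma + c]]%classic.

(* Main.v *)
Require Import Defs.
From mathcomp Require Import all_boot all_order all_algebra.
From mathcomp Require Import finmap boolp classical_sets.
From mathcomp Require Import zify ring.

Import Order.TTheory GRing.Theory Num.Theory.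

Local Open Scope ring_scope.

(* Let [m] be the coordinatewise median of [z1], [z2], [z3].  Joining [m] to each
   [zi] by monotone paths gives a minimal tree, of size the half-perimeter of the
   bounding box, and the path to [zi] may run through any point of the rectangle
   [Ri] spanned by [zi] and [m]; so a fourth point [z] can be attached at cost
   dist(z, Ri).  Conversely, in a tree containing all four points, [z] hangs off
   one of the three arms, at a point [p] between some [zi] and the branching point
   [t]; minimising the resulting sum of distances coordinate by coordinate gives
   exactly the half-perimeter plus dist(z, Ri).  Finally the i-th octagon is the
   L1-ball of radius c around [Ri]. *)

(** * Tree lengths in a single coordinate *)

Definition interval_dist (a b x : int) : int := Num.max 0 (Num.max (a - x) (x - b)).

Definition spread (a b c : int) : int :=
  Num.max a (Num.max b c) - Num.min a (Num.min b c).

Definition median (a b c : int) : int :=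
  Num.max (Num.min a b) (Num.min (Num.max a b) c).

(** By distributivity, [arm_lo] and [arm_hi] are the smaller and the larger of [a] and the median of
    the three numbers. *)
Definition arm_lo (a b c : int) : int := Num.max (Num.min a b) (Num.min a c).
Definition arm_hi (a b c : int) : int := Num.min (Num.max a b) (Num.max a c).
Definition clamp (a b x : int) : int := Num.max a (Num.min x b).

Ltac split_minmax :=
  repeat match goal with
  | |- context [Order.min ?u ?v] => case: (leP u v) => ?
  | |- context [Order.max ?u ?v] => case: (leP u v) => ?
  end.

Lemma spread_le (a b c t : int) : spread a b c <= `|t - a| + `|t - b| + `|t - c|.
Proof. by rewrite /spread; split_minmax; lia. Qed.

Lemma spread_median (a b c : int) :
  `|median a b c - a| + `|median a b c - b| + `|median a b c - c| = spread a b c.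
Proof.
by rewrite /spread /median; split_minmax; lia.
Qed.

(** Moving [p] out of the arm interval by some amount lengthens the tree on [a], [b], [c] by at
    least as much, and the distance from [x] to the interval is at most [|p - x|] plus that
    amount. *)
Lemma coord_lower (a b c x p t : int) :
  spread a b c + interval_dist (arm_lo a b c) (arm_hi a b c) x
    <= `|a - p| + `|p - t| + `|t - b| + `|t - c| + `|p - x|.
Proof.
rewrite /spread /interval_dist /arm_lo /arm_hi.
case: (leP a b) => ab; case: (leP b c) => bc; case: (leP a c) => ac.
all: by split_minmax; lia.
Qed.

(** The equality case of [coord_lower]: branch at the median and attach [x] at its nearest point of
    the arm. *)
Lemma coord_upper (a b c x : int) (m := median a b c)
    (p := clamp (arm_lo a b c) (arm_hi a b c) x) :
  `|m - b| + `|m - c| + `|m - p| + `|p - a| + `|p - x|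
    = spread a b c + interval_dist (arm_lo a b c) (arm_hi a b c) x.
Proof.
rewrite /m /p /clamp /median /spread /interval_dist /arm_lo /arm_hi.
case: (leP a b) => ab; case: (leP b c) => bc; case: (leP a c) => ac.
all: by split_minmax; lia.
Qed.

(** * The L1 metric on the grid *)

Definition gdist (z z' : gpoint) : int := `|z.1 - z'.1| + `|z.2 - z'.2|.

Lemma fset2_inj (K : choiceType) (a b c d : K) :
  [fset a; b]%fset = [fset c; d]%fset -> (a = c /\ b = d) \/ (a = d /\ b = c).
Proof.
move=> E.
have: a \in [fset c; d]%fset by rewrite -E fset21.
have: b \in [fset c; d]%fset by rewrite -E fset22.
have: c \in [fset a; b]%fset by rewrite E fset21.
have: d \in [fset a; b]%fset by rewrite E fset22.
by rewrite !inE => /orP[]/eqP ? /orP[]/eqP ? /orP[]/eqP ? /orP[]/eqP ?; subst; auto.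
Qed.

Lemma gdist_eq0 (u v : gpoint) : gdist u v = 0 -> u = v.
Proof. by case: u v => [a b] [c d]; rewrite /gdist /= => H; congr pair; lia. Qed.

Lemma gdist_refl (u : gpoint) : gdist u u = 0.
Proof. by rewrite /gdist; lia. Qed.

Lemma gdist_sym (u v : gpoint) : gdist u v = gdist v u.
Proof. by rewrite /gdist; lia. Qed.

Lemma gdist_triangle (v u w : gpoint) : gdist u w <= gdist u v + gdist v w.
Proof. by rewrite /gdist; lia. Qed.

Lemma grid_adj_sym (u v : gpoint) : grid_adj u v = grid_adj v u.
Proof. by rewrite /grid_adj; congr (_ == _); lia. Qed.

(** * Lower bounds: edge-disjoint walks in a connected subgraph *)

Section Subgraph.
Variable G : Defs.fgraph.
Hypothesis gridG : grid_subgraph G.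

Lemma adj_sym (u v : gpoint) : adj G u v = adj G v u.
Proof. by rewrite /adj fsetUC. Qed.

Lemma adj_grid (u v : gpoint) : adj G u v -> grid_adj u v.
Proof.
by move=> /gridG[a [b [_ _ ab /fset2_inj[]]]] [-> ->] //; rewrite grid_adj_sym.
Qed.

Lemma adj_vertex (u v : gpoint) : adj G u v -> u \in vertices G.
Proof. by move=> /gridG[a [b [? ? _ /fset2_inj[]]]] [-> _]. Qed.

Lemma walk_dist (u p : gpoint) (w : seq gpoint) :
  path grid_adj u w -> p \in u :: w ->
  gdist u p + gdist p (last u w) <= (size w)%:Z.
Proof.
elim: w u p => [|y w IH] u p /=.
  by rewrite inE => _ /eqP ->; rewrite gdist_refl.
move=> /andP[/eqP uy yw]; rewrite -/(gdist u y) in uy.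
rewrite inE => /predU1P[->|/(IH _ _ yw)].
  have := IH _ _ yw (mem_head y w); have := gdist_triangle y u (last y w).
  by rewrite !gdist_refl; lia.
by have := gdist_triangle y u p; lia.
Qed.

(** The alternatives correspond to which of [p] and [q] the walk meets first. *)
Lemma walk_dist2 (u p q : gpoint) (w : seq gpoint) :
  path grid_adj u w -> p \in u :: w -> q \in u :: w ->
  gdist u p + gdist p q + gdist q (last u w) <= (size w)%:Z \/
  gdist u q + gdist q p + gdist p (last u w) <= (size w)%:Z.
Proof.
elim: w u => [|y w IH] u.
  by rewrite !inE => _ /eqP -> /eqP ->; rewrite !gdist_refl; left.
move=> uw; have /= /andP[/eqP uy yw] := uw.
rewrite in_cons => /predU1P[->|pw] qw.
  by left; rewrite gdist_refl add0r; apply: walk_dist uw qw.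
move: qw; rewrite in_cons => /predU1P[->|qw].
  by right; rewrite gdist_refl add0r; apply: walk_dist uw _; rewrite in_cons pw orbT.
rewrite -/(gdist u y) in uy.
have := gdist_triangle y u p; have := gdist_triangle y u q.
by case: (IH _ yw pw qw) => H; [left | right] => /=; lia.
Qed.

Hypothesis connG : connected_graph G.

(* The invariant [F] inside [S] makes the edges of the new walk, each of which
   has an endpoint outside [S], disjoint from [F]. *)
Definition part (S : {fset gpoint}) (F : {fset {fset gpoint}}) : Prop :=
  [/\ {subset S <= vertices G}, {subset F <= edges G}
    & forall e, e \in F -> {subset e <= S}].

(** The walk [w] is [p] cut at its first vertex in [S]. The clause that [w] stays within [p] lets
    the uniqueness of [z :: p] show that [z] is not revisited. *)
Lemma part_attach_walk (S : {fset gpoint}) (F : {fset {fset gpoint}})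
    (z : gpoint) (p : seq gpoint) :
  part S F -> path (adj G) z p -> uniq (z :: p) -> last z p \in S ->
  exists (w : seq gpoint) (S' : {fset gpoint}) (F' : {fset {fset gpoint}}),
    [/\ path grid_adj z w /\ {subset w <= p}, last z w \in S, part S' F',
        S' =i [predU S & z :: w] & #|` F'|%fset = (#|` F|%fset + size w)%N].
Proof.
move=> SF; have stop y q : y \in S ->
  exists (w : seq gpoint) (S' : {fset gpoint}) (F' : {fset {fset gpoint}}),
    [/\ path grid_adj y w /\ {subset w <= q}, last y w \in S, part S' F',
        S' =i [predU S & y :: w] & #|` F'|%fset = (#|` F|%fset + size w)%N].
  move=> yS; exists [::], S, F; split=> //; last by rewrite addn0.
  by move=> v; rewrite !inE; case: eqP => [->|]; rewrite ?yS ?orbF.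
elim: p z => [|y p IH] z; first by move=> _ _; apply: stop.
rewrite [path _ _ _]/= [uniq _]/= [last _ _]/= => /andP[zy yp] /andP[zNp up] lS.
have [zS|zNS] := boolP (z \in S); first exact: stop.
have [w [S' [F' [[yw wp] lw [SV FE FS] S'E cF]]]] := IH y yp up lS.
exists (y :: w), (z |` S')%fset, ([fset z; y] |` F')%fset; split => //.
- split; first by rewrite /= (adj_grid _ _ zy).
  by move=> v; rewrite !inE => /predU1P[->|/wp->]; rewrite ?eqxx ?orbT.
- split.
  + by move=> v; rewrite !inE => /predU1P[->|/SV//]; apply: adj_vertex zy.
  + by move=> e; rewrite !inE => /predU1P[->|/FE].
  + move=> e; rewrite !inE => /predU1P[->|/FS eS] v; last first.
      by move=> /eS; rewrite !inE => ->; rewrite orbT.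
    by rewrite !inE S'E !inE => /orP[]->; rewrite ?orbT.
- by move=> v; rewrite !inE S'E !inE; case: (v == z); rewrite ?orbT.
- rewrite cardfsU1 cF /= addnS.
  suff -> : [fset z; y]%fset \notin F' by [].
  (* Were this edge already in [F'], its endpoint [z] would lie in [S] or on the walk from [y]. *)
  apply/negP => /FS /(_ _ (fset21 z y)); rewrite S'E !inE (negPf zNS) /= => zyw.
  by move: zNp; rewrite inE; case/predU1P: zyw => [->|/wp->]; rewrite ?eqxx ?orbT.
Qed.

Lemma part_attach (S : {fset gpoint}) (F : {fset {fset gpoint}}) (s z : gpoint) :
  part S F -> s \in S -> z \in vertices G ->
  exists (w : seq gpoint) (S' : {fset gpoint}) (F' : {fset {fset gpoint}}),
    [/\ path grid_adj z w, last z w \in S, part S' F',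
        S' =i [predU S & z :: w] & #|` F'|%fset = (#|` F|%fset + size w)%N].
Proof.
move=> SF sS zV; have [SV _ _] := SF.
have [_ /(_ z s zV (SV _ sS))[p [zp zs]]] := connG.
move: zs; case/shortenP: zp => p' zp' up' _ zs.
have lS : last z p' \in S by rewrite zs.
by have [w [S' [F' [[? _] ? ? ? ?]]]] := part_attach_walk _ _ _ _ SF zp' up' lS;
  exists w, S', F'.
Qed.

(* The three walks are edge-disjoint: [z1]-[z2], then [z3] to its first hit [t]
   of the first walk, then [z4] to its first hit [p] of the first two. *)
Lemma steiner_lower (z1 z2 z3 z4 : gpoint) :
  {subset [:: z1; z2; z3; z4] <= vertices G} ->
  exists p t : gpoint, exists n : nat, (n <= #|` edges G|%fset)%N /\
  [\/ gdist z1 p + gdist p t + gdist t z2 + gdist t z3 + gdist p z4 <= n%:Z,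
      gdist z2 p + gdist p t + gdist t z1 + gdist t z3 + gdist p z4 <= n%:Z |
      gdist z3 p + gdist p t + gdist t z1 + gdist t z2 + gdist p z4 <= n%:Z].
Proof.
move=> sV.
have P0 : part [fset z1]%fset fset0.
  split=> [v|e|e]; rewrite inE //.
  by move=> /eqP ->; apply: sV; rewrite inE eqxx.
have [|w2 [S2 [F2 [zw2 l2 P2 S2E c2]]]] := part_attach _ _ z1 z2 P0 (fset11 z1).
  by apply: sV; rewrite !inE eqxx ?orbT.
have z1S2 : z1 \in S2 by rewrite S2E !inE eqxx.
have [|w3 [S3 [F3 [zw3 l3 P3 S3E c3]]]] := part_attach _ _ z1 z3 P2 z1S2.
  by apply: sV; rewrite !inE eqxx ?orbT.
have z1S3 : z1 \in S3 by rewrite S3E !inE z1S2.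
have [|w4 [S4 [F4 [zw4 l4 [_ F4E _] _ c4]]]] := part_attach _ _ z1 z4 P3 z1S3.
  by apply: sV; rewrite !inE eqxx ?orbT.
have S2w v : v \in S2 -> v \in z2 :: w2.
  rewrite S2E inE => /orP[|//]; rewrite inE => /eqP ->.
  by move: l2; rewrite inE => /eqP <-; apply: mem_last.
have {l2} e2 : last z2 w2 = z1 by apply/eqP; rewrite -in_fset1.
set p := last z4 w4; set t := last z3 w3.
have d4 : gdist p z4 <= (size w4)%:Z.
  by have := walk_dist _ _ _ zw4 (mem_head _ _); rewrite gdist_refl add0r gdist_sym.
have d3 : gdist t z3 <= (size w3)%:Z.
  by have := walk_dist _ _ _ zw3 (mem_head _ _); rewrite gdist_refl add0r gdist_sym.
exists p, t, (size w2 + size w3 + size w4)%N; split.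
  have -> : (size w2 + size w3 + size w4)%N = #|` F4|%fset.
    by rewrite c4 c3 c2 cardfs0.
  by apply: fsubset_leq_card; apply/fsubsetP.
have tw := S2w _ l3.
(* If [p] is on the first walk, its order relative to [t] decides between the arms of [z2] and [z1];
   otherwise [p] is on the arm of [z3]. *)
move: l4; rewrite S3E inE => /orP[/S2w|] pw.
  case: (walk_dist2 _ _ _ _ zw2 pw tw); rewrite e2 -/p -/t => H.
    by apply: Or32; lia.
  by rewrite (gdist_sym z2) (gdist_sym t p) (gdist_sym p z1) in H; apply: Or31; lia.
have := walk_dist _ _ _ zw3 pw; have := walk_dist _ _ _ zw2 tw.
by rewrite e2 -/t -/p (gdist_sym z2) => H2 H3; apply: Or33; lia.
Qed.

(** Repeat [z3] as fourth point in [steiner_lower], drop the branch to it, and shortcut [p] by the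
    triangle inequality. *)
Lemma steiner_lower3 (z1 z2 z3 : gpoint) :
  {subset [:: z1; z2; z3] <= vertices G} ->
  exists t, gdist t z1 + gdist t z2 + gdist t z3 <= #|` edges G|%fset%:Z.
Proof.
move=> sV.
have [|p [t [n [nE H]]]] := steiner_lower z1 z2 z3 z3.
  by move=> v vs; apply: sV; move: vs; rewrite !inE orbb.
have tri z : gdist t z <= gdist z p + gdist p t.
  by rewrite (gdist_sym t) gdist_triangle.
have t1 := tri z1; have t2 := tri z2; have t3 := tri z3.
have pz3 : 0 <= gdist p z3 by apply: addr_ge0.
exists t; case: H => H; lia.
Qed.
End Subgraph.

(** * Upper bounds: growing trees leaf by leaf *)

Section Growth.
Variable G : Defs.fgraph.
Hypothesis treeG : grid_tree G.

(** The only neighbour of [u] is [v], so a cycle of length above 2 through [u] would visit [v] both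
    just before and just after [u]. A cycle avoiding [u] already lies in [G]. *)
Lemma tree_add_leaf (u v : gpoint) :
  v \in vertices G -> u \notin vertices G -> grid_adj v u ->
  grid_tree (FGraph (u |` vertices G)%fset ([fset v; u] |` edges G)%fset).
Proof.
have [gridG [_ connG] acyG] := treeG.
move=> vV uNV vu; set G' := FGraph _ _.
have vNu : v != u by apply: contraNneq uNV => <-.
have adjG' a b : adj G' a b = [|| adj G a b, (a == v) && (b == u) | (a == u) && (b == v)].
  rewrite {1}/adj /= !inE orbC; congr (_ || _).
  apply/eqP/orP => [/fset2_inj[][-> ->]|[]/andP[/eqP -> /eqP ->]].
  - by left; rewrite !eqxx.
  - by right; rewrite !eqxx.
  - by [].
  - by rewrite fsetUC.
have subadj : subrel (adj G) (adj G') by move=> a b ab; rewrite adjG' ab.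
have adju a : adj G' a u -> a = v.
  rewrite adjG' eqxx andbT; case/or3P => [|/eqP//|/andP[_ /eqP uv]].
    by rewrite adj_sym => /(adj_vertex _ gridG); rewrite (negPf uNV).
  by rewrite uv eqxx in vNu.
have adjul a : adj G' u a -> a = v by rewrite adj_sym; apply: adju.
have toV a : a \in vertices G' ->
  exists p, path (adj G') a p /\ last a p = v.
  rewrite !inE => /predU1P[->|aV].
    by exists [:: v]; rewrite /= adjG' !eqxx !orbT.
  by have [p [ap lp]] := connG a v aV vV; exists p; split=> //; apply: sub_path ap.
have fromV a : a \in vertices G' ->
  exists p, path (adj G') v p /\ last v p = a.
  rewrite !inE => /predU1P[->|aV].
    by exists [:: u]; rewrite /= adjG' !eqxx !orbT.
  by have [p [ap lp]] := connG v a vV aV; exists p; split=> //; apply: sub_path ap.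
split.
- move=> e; rewrite !inE => /predU1P[->|/gridG[a [b [aV bV ab ->]]]].
    by exists v, u; split=> //; rewrite !inE ?eqxx ?vV ?orbT.
  by exists a, b; split=> //; rewrite !inE ?aV ?bV orbT.
- split; first by exists v; rewrite !inE vV orbT.
  move=> a b /toV[p [ap lp]] /fromV[q [vq lq]].
  by exists (p ++ q); rewrite cat_path last_cat lp ap vq.
- move=> s s2 /andP[cs us].
  have [us'|uNs] := boolP (u \in s).
    have /rot_to[i s' E] := us'.
    have : cycle (adj G') (u :: s') by rewrite -E rot_cycle.
    have : uniq (u :: s') by rewrite -E rot_uniq.
    have : (2 < size (u :: s'))%N by rewrite -E size_rot.
    case: s' {E} => [//|a s'].
    case/lastP: s' => [//|s' b] _ /=.
    rewrite mem_rcons => /and3P[_ aNs _] /andP[/adjul av].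
    rewrite rcons_path last_rcons => /andP[_ /adju bv].
    by move: aNs; rewrite av bv in_cons eqxx.
  apply: (acyG s s2); rewrite /ucycle us andbT.
  apply: (@sub_in_cycle _ (mem s) (adj G')) cs; last exact/allP.
  move=> a b sa sb; rewrite adjG'.
  case/or3P => [//|/andP[_ /eqP bu]|/andP[/eqP au _]].
    by rewrite bu (negPf uNs) in sb.
  by rewrite au (negPf uNs) in sa.
Qed.
End Growth.

(** Approach [z] by unit steps: a step to a vertex of the tree is free, any other adds a leaf. Hence
    only an upper bound on the edges. *)
Lemma tree_attach_nat (n : nat) (G : Defs.fgraph) (v z : gpoint) :
  grid_tree G -> v \in vertices G -> gdist v z = n%:Z ->
  exists G' : Defs.fgraph,
    [/\ grid_tree G', {subset vertices G <= vertices G'}, z \in vertices G'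
      & (#|` edges G'|%fset <= #|` edges G|%fset + n)%N].
Proof.
elim: n G v => [|n IH] G v treeG vV vz.
  by exists G; rewrite addn0 -(gdist_eq0 _ _ vz); split.
have [u vu uz] : exists2 u, grid_adj v u & gdist u z = n%:Z.
  case: v z {vV IH} vz => [a b] [a' b']; rewrite /gdist /= => vz.
  case: (ltrgtP a a') => aa.
  - by exists (a + 1, b); rewrite /grid_adj /=; lia.
  - by exists (a - 1, b); rewrite /grid_adj /=; lia.
  (* The distance [n + 1] is now all in the second coordinate, so [b = b'] cannot occur. *)
  - case: (lerP b b') => bb.
      by exists (a, b + 1); rewrite /grid_adj /=; lia.
    by exists (a, b - 1); rewrite /grid_adj /=; lia.
have [uV|uNV] := boolP (u \in vertices G).
  have [G' [? ? ? le]] := IH G u treeG uV uz.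
  by exists G'; split=> //; apply: leq_trans le _; rewrite leq_add2l.
have [|G' [treeG' sub zG' le]] := IH _ u (tree_add_leaf _ treeG _ _ vV uNV vu) _ uz.
  by rewrite !inE eqxx.
exists G'; split=> //.
  by move=> w wV; apply: sub; rewrite !inE wV orbT.
apply: leq_trans le _; by rewrite /= cardfsU1 addnS -addSn leq_add2r -add1n leq_add2r leq_b1.
Qed.

Lemma tree_attach (G : Defs.fgraph) (v z : gpoint) :
  grid_tree G -> v \in vertices G ->
  exists G' : Defs.fgraph,
    [/\ grid_tree G', {subset vertices G <= vertices G'}, z \in vertices G'
      & #|` edges G'|%fset%:Z <= #|` edges G|%fset%:Z + gdist v z].
Proof.
move=> treeG vV; have dN : gdist v z = `|gdist v z|%N by rewrite gez0_abs // addr_ge0.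
have [G' [? ? ? le]] := tree_attach_nat _ _ _ _ treeG vV dN.
by exists G'; split=> //; rewrite dN -PoszD lez_nat.
Qed.

Lemma tree_point (z : gpoint) : grid_tree (FGraph [fset z]%fset fset0).
Proof.
split.
- by move=> e; rewrite inE.
- split; first by exists z; rewrite inE.
  by move=> u v; rewrite !inE => /eqP -> /eqP ->; exists [::].
- by case=> [|a [|b s]] // _ /andP[]; rewrite /= /adj inE.
Qed.

(** A witness yields a least element, so [xget] does not fall back on its default. *)
Lemma min_nat_spec (P : nat -> Prop) (n : nat) :
  P n -> P (min_nat P) /\ (min_nat P <= n)%N.
Proof.
move=> Pn; rewrite /min_nat; case: xgetP => [m _ [Pm mP]|noP].
  by split=> //; apply: mP.
have ex : exists k, `[< P k >] by exists n; apply/asboolP.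
case: (ex_minnP ex) => m /asboolP Pm mmin.
by case: (noP m); split=> // k Pk; apply: mmin; apply/asboolP.
Qed.

Lemma steiner_upper3 (z1 z2 z3 t : gpoint) :
  exists2 n : nat, spanned_by [:: z1; z2; z3] n &
    n%:Z <= gdist t z1 + gdist t z2 + gdist t z3.
Proof.
have [G1 [T1 S1 M1 E1]] := tree_attach _ _ z1 (tree_point t) (fset11 t).
have [G2 [T2 S2 M2 E2]] := tree_attach _ _ z2 T1 (S1 _ (fset11 t)).
have [G3 [T3 S3 M3 E3]] := tree_attach _ _ z3 T2 (S2 _ (S1 _ (fset11 t))).
exists #|` edges G3|%fset.
  exists G3; split=> // v; rewrite !inE.
  by case/or3P => /eqP ->; rewrite ?M3 // S3 // ?M2 // S2.
by rewrite cardfs0 in E1; lia.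
Qed.

(** One tree serves every list [s] drawn from the four points, which later allows the terminals to
    be permuted. *)
Lemma steiner_upper (z1 z2 z3 z4 p t : gpoint) :
  exists2 n : nat,
    (forall s, {subset s <= [:: z1; z2; z3; z4]} -> spanned_by s n) &
    n%:Z <= gdist z1 p + gdist p t + gdist t z2 + gdist t z3 + gdist p z4.
Proof.
have [G1 [T1 S1 M1 E1]] := tree_attach _ _ z1 (tree_point p) (fset11 p).
have [G2 [T2 S2 M2 E2]] := tree_attach _ _ t T1 (S1 _ (fset11 p)).
have [G3 [T3 S3 M3 E3]] := tree_attach _ _ z2 T2 M2.
have [G4 [T4 S4 M4 E4]] := tree_attach _ _ z3 T3 (S3 _ M2).
have pG4 : p \in vertices G4 by rewrite S4 // S3 // S2 // S1 // fset11.
have [G5 [T5 S5 M5 E5]] := tree_attach _ _ z4 T4 pG4.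
exists #|` edges G5|%fset.
  move=> s ss; exists G5; split=> // v /ss; rewrite !inE.
  by case/or4P => /eqP ->; rewrite ?M5 // S5 // ?M4 // S4 // ?M3 // S3 // S2.
by rewrite cardfs0 in E1; rewrite (gdist_sym z1); lia.
Qed.

(** * Octagons as L1-balls, and the values of the tristance and quadristance *)

Lemma arm_le (a b c : int) : arm_lo a b c <= arm_hi a b c.
Proof. by rewrite /arm_lo /arm_hi; split_minmax; lia. Qed.

Lemma spread_swap (a b c : int) : spread b a c = spread a b c.
Proof. by rewrite /spread maxCA minCA. Qed.

Lemma spread_rot (a b c : int) : spread c a b = spread a b c.
Proof. by rewrite spread_swap /spread [Num.max c b]maxC [Num.min c b]minC. Qed.

(** A sum of two three-term maxima is the maximum of nine sums: one gives [0 <= c], the other eight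
    are the sides of the octagon. *)
Lemma octagonP (c a b g d : int) (z : gpoint) : 0 <= c -> a <= b -> g <= d ->
  octagon c a b g d z <-> interval_dist a b z.1 + interval_dist g d z.2 <= c.
Proof.
move=> c0 ab gd; rewrite /octagon /interval_dist /=.
split.
  case=> /andP[? ?] /andP[? ?] /andP[? ?] /andP[? ?].
  by split_minmax; lia.
by split_minmax => ?; split; apply/andP; split; lia.
Qed.

(* The intervals [arm_lo, arm_hi] of the two coordinates bound the rectangle
   spanned by [z1] and the coordinatewise median of the three points. *)
Definition arm_dist (z1 z2 z3 z : gpoint) : int :=
  interval_dist (arm_lo z1.1 z2.1 z3.1) (arm_hi z1.1 z2.1 z3.1) z.1 +
  interval_dist (arm_lo z1.2 z2.2 z3.2) (arm_hi z1.2 z2.2 z3.2) z.2.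

Definition box_size (z1 z2 z3 : gpoint) : int :=
  spread z1.1 z2.1 z3.1 + spread z1.2 z2.2 z3.2.

Lemma arm_dist_lower (z1 z2 z3 z p t : gpoint) :
  box_size z1 z2 z3 + arm_dist z1 z2 z3 z
    <= gdist z1 p + gdist p t + gdist t z2 + gdist t z3 + gdist p z.
Proof.
have := coord_lower z1.1 z2.1 z3.1 z.1 p.1 t.1.
have := coord_lower z1.2 z2.2 z3.2 z.2 p.2 t.2.
rewrite /box_size /arm_dist /gdist => H2 H1.
by rewrite addrACA; apply: le_trans (lerD H1 H2) _; rewrite le_eqVlt; apply/orP; left; apply/eqP; ring.
Qed.

(** The coordinates can be optimised independently: [t] is the coordinatewise median and [p] the
    projection of [z] onto the rectangle spanned by [z1] and [t]. *)
Lemma arm_dist_upper (z1 z2 z3 z : gpoint) : exists p t : gpoint,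
  gdist z1 p + gdist p t + gdist t z2 + gdist t z3 + gdist p z
    = box_size z1 z2 z3 + arm_dist z1 z2 z3 z.
Proof.
pose a := clamp (arm_lo z1.1 z2.1 z3.1) (arm_hi z1.1 z2.1 z3.1) z.1.
pose b := clamp (arm_lo z1.2 z2.2 z3.2) (arm_hi z1.2 z2.2 z3.2) z.2.
exists (a, b), (median z1.1 z2.1 z3.1, median z1.2 z2.2 z3.2).
rewrite /box_size /arm_dist [RHS]addrACA -!coord_upper -/a -/b (gdist_sym z1).
by rewrite (gdist_sym (a, b) (median _ _ _, _)) /gdist /=; ring.
Qed.

Lemma box_size_le (z1 z2 z3 t : gpoint) :
  box_size z1 z2 z3 <= gdist t z1 + gdist t z2 + gdist t z3.
Proof.
apply: le_trans (lerD (spread_le _ _ _ t.1) (spread_le _ _ _ t.2)) _.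
by rewrite le_eqVlt; apply/orP; left; apply/eqP; rewrite /gdist; ring.
Qed.

Lemma box_size_median (z1 z2 z3 : gpoint)
    (t := (median z1.1 z2.1 z3.1, median z1.2 z2.2 z3.2) : gpoint) :
  gdist t z1 + gdist t z2 + gdist t z3 = box_size z1 z2 z3.
Proof. by rewrite /box_size -!spread_median /gdist /t /=; ring. Qed.

Lemma tristanceE (z1 z2 z3 : gpoint) :
  (tristance z1 z2 z3)%:Z = box_size z1 z2 z3.
Proof.
pose t := (median z1.1 z2.1 z3.1, median z1.2 z2.2 z3.2).
have [n sn nle] := steiner_upper3 z1 z2 z3 t.
have [[G [[gridG connG _] sV cE]] dle] := min_nat_spec _ _ sn.
have [u ule] := steiner_lower3 _ gridG connG _ _ _ sV; rewrite cE in ule.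
apply/eqP; rewrite eq_le (le_trans (box_size_le _ _ _ u) ule) andbT.
by rewrite -box_size_median; apply: le_trans nle; rewrite lez_nat.
Qed.

Lemma quadristance_lower (z1 z2 z3 z : gpoint) (d : int) :
  (quadristance z1 z2 z3 z)%:Z <= d ->
  [\/ box_size z1 z2 z3 + arm_dist z1 z2 z3 z <= d,
      box_size z2 z1 z3 + arm_dist z2 z1 z3 z <= d |
      box_size z3 z1 z2 + arm_dist z3 z1 z2 z <= d].
Proof.
(* Any spanning tree will do here: its existence makes the minimum attained. *)
move=> qd; have [n sn _] := steiner_upper z1 z2 z3 z z z.
have [[G [[gridG connG _] sV cE]] _] :=
  min_nat_spec _ _ (sn [:: z1; z2; z3; z] (fun _ => id)).
have [p [t [m [mE H]]]] := steiner_lower _ gridG connG _ _ _ _ sV.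
rewrite cE -lez_nat -/(quadristance z1 z2 z3 z) in mE.
have md := le_trans mE qd.
by case: H => H; [apply: Or31 | apply: Or32 | apply: Or33];
  exact: le_trans (arm_dist_lower _ _ _ _ p t) (le_trans H md).
Qed.

(** The free order of [w1], [w2], [w3] lets any of the three points play the role of the arm's end
    [z1]. *)
Lemma quadristance_upper (z1 z2 z3 z w1 w2 w3 : gpoint) :
  {subset [:: w1; w2; w3; z] <= [:: z1; z2; z3; z]} ->
  (quadristance w1 w2 w3 z)%:Z <= box_size z1 z2 z3 + arm_dist z1 z2 z3 z.
Proof.
move=> sub; have [p [t <-]] := arm_dist_upper z1 z2 z3 z.
have [n sn nle] := steiner_upper z1 z2 z3 z p t.
have [_ qn] := min_nat_spec _ _ (sn _ sub).
by apply: le_trans nle; rewrite lez_nat.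
Qed.

Theorem theorem36 (x1 y1 x2 y2 x3 y3 d : int) :
  let z1 : gpoint := (x1, y1) in
  let z2 : gpoint := (x2, y2) in
  let z3 : gpoint := (x3, y3) in
  z1 <> z2 -> z1 <> z3 -> z2 <> z3 ->
  (tristance z1 z2 z3)%:Z <= d ->
  let c := d - (tristance z1 z2 z3)%:Z in
  let alpha1 := Num.max (Num.min x1 x2) (Num.min x1 x3) in
  let beta1  := Num.min (Num.max x1 x2) (Num.max x1 x3) in
  let gamma1 := Num.max (Num.min y1 y2) (Num.min y1 y3) in
  let delta1 := Num.min (Num.max y1 y2) (Num.max y1 y3) in
  let alpha2 := Num.max (Num.min x1 x2) (Num.min x2 x3) in
  let beta2  := Num.min (Num.max x1 x2) (Num.max x2 x3) in
  let gamma2 := Num.max (Num.min y1 y2) (Num.min y2 y3) in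
  let delta2 := Num.min (Num.max y1 y2) (Num.max y2 y3) in
  let alpha3 := Num.max (Num.min x1 x3) (Num.min x2 x3) in
  let beta3  := Num.min (Num.max x1 x3) (Num.max x2 x3) in
  let gamma3 := Num.max (Num.min y1 y3) (Num.min y2 y3) in
  let delta3 := Num.min (Num.max y1 y3) (Num.max y2 y3) in
  anticode d z1 z2 z3 =
    (octagon c alpha1 beta1 gamma1 delta1
     `|` octagon c alpha2 beta2 gamma2 delta2
     `|` octagon c alpha3 beta3 gamma3 delta3)%classic.
Proof.
move=> z1 z2 z3 _ _ _ d3d c a1 b1 g1 d1 a2 b2 g2 d2 a3 b3 g3 d3.
have c0 : 0 <= c by rewrite subr_ge0.
have o1 z : octagon c a1 b1 g1 d1 z <-> arm_dist z1 z2 z3 z <= c.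
  by apply: (octagonP _ _ _ _ _ _ c0); apply: arm_le.
have o2 z : octagon c a2 b2 g2 d2 z <-> arm_dist z2 z1 z3 z <= c.
  (* Commuting the inner minima and maxima puts the second point first, as in [arm_lo x2 x1 x3]. *)
  rewrite /a2 /b2 /g2 /d2 (minC x1 x2) (maxC x1 x2) (minC y1 y2) (maxC y1 y2).
  by apply: (octagonP _ _ _ _ _ _ c0); apply: arm_le.
have o3 z : octagon c a3 b3 g3 d3 z <-> arm_dist z3 z1 z2 z <= c.
  rewrite /a3 /b3 /g3 /d3 (minC x1 x3) (maxC x1 x3) (minC y1 y3) (maxC y1 y3).
  rewrite (minC x2 x3) (maxC x2 x3) (minC y2 y3) (maxC y2 y3).
  by apply: (octagonP _ _ _ _ _ _ c0); apply: arm_le.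
have box2 : box_size z2 z1 z3 = box_size z1 z2 z3.
  by rewrite /box_size (spread_swap z1.1) (spread_swap z1.2).
have box3 : box_size z3 z1 z2 = box_size z1 z2 z3.
  by rewrite /box_size (spread_rot z1.1) (spread_rot z1.2).
(* The tristance is the box size, so [c] is exactly the length left for attaching [z]. *)
have cE a : (a <= c) = (box_size z1 z2 z3 + a <= d) by rewrite /c tristanceE lerBrDl.
apply/seteqP; split=> z /=.
  case/quadristance_lower; rewrite ?box2 ?box3 -cE => H.
  - by left; left; apply/o1.
  - by left; right; apply/o2.
  - by right; apply/o3.
rewrite /anticode /= => -[[/o1|/o2]|/o3]; rewrite cE => H.
- exact: le_trans (quadristance_upper z1 z2 z3 z z1 z2 z3 (fun _ => id)) H.
- rewrite -box2 in H; apply: le_trans (quadristance_upper z2 z1 z3 z _ _ _ _) H.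
  by move=> v; rewrite !inE orbCA.
- rewrite -box3 in H; apply: le_trans (quadristance_upper z3 z1 z2 z _ _ _ _) H.
  by move=> v; rewrite !inE => /or4P[] ->; rewrite ?orbT.
Qed.
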